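(* Let $n\ge 4$ and let $L=T(2,n)$ be the standard projection of the $(2,n)$-torus link. The I-generating function $f(L)$ of $L$ is $$f(L)=1+(n+2)x+\sum_{k=2}^{\lfloor n/2\rfloor}\binom{n-k}{k}\frac{n}{n-k}\,x^k .$$
   Context: A link projection is a regular projection of a link on $S^2$ whose only intersections are transverse double points, called crossings. Regions are the connected components of the complement of the projection in $S^2$. Two distinct regions are connected if they share a crossing on their boundaries, and disconnected otherwise. A set $W$ of regions is isolated if any two distinct regions in $W$ are disconnected (the empty set is isolated). The I-generating function of a link projection $L$ is the polynomial $f(L)=\sum_{W}x^{|W|}$, where the sum runs over all isolated sets $W$ of regions of $L$; i.e. the coefficient of $x^k$ is the number of isolated sets consisting of $k$ regions. The standard projection $T(2,n)$ of the $(2,n)$-torus link is the projection of the closure of the 2-braid $\sigma_1^n$: it has $n$ crossings and $n+2$ regions, namely $n$ regions $x_1,\dots,x_n$ arranged cyclically, each a bigon lying between two cyclically consecutive crossings (cyclically consecutive bigons share exactly the crossing between them when $n\geq 3$), and two further regions $x_{n+1},x_{n+2}$, each an $n$-gon having all $n$ crossings on its boundary. *)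

(* Defs.v *)
From HB Require Import structures.
From mathcomp Require Import all_boot all_order all_algebra finmap.
From mathcomp Require Import all_classical all_reals all_analysis.
From mathcomp Require Import ring lra.

Set Implicit Arguments.
Unset Strict Implicit.
Unset Printing Implicit Defensive.

Import Order.TTheory GRing.Theory Num.Theory.
Import numFieldNormedType.Exports.

Local Open Scope classical_set_scope.
Local Open Scope ring_scope.

Definition sphere2 {R : realType} : set 'rV[R]_3 :=
  [set p | \sum_(j < 3) p 0 j ^+ 2 = 1].

(* Each circle is R/Z, with [0, 1[ as a set of representatives of its points. *)
Definition preimages (R : realType) (I : finType) (c : I -> R -> 'rV[R]_3)
    (p : 'rV[R]_3) : set (I * R) :=
  [set u | 0 <= u.2 < 1 /\ c u.1 u.2 = p].

(* A regular projection on S^2 of a link: a nonempty finite family of closed C^1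
   immersed curves on S^2 whose only multiple points are transverse double
   points. There are then finitely many crossings, by compactness. *)
Record link_projection (R : realType) := LinkProjection {
  lp_index : finType;
  lp_curve : lp_index -> R -> 'rV[R]_3;
  lp_nonempty : (0 < #|lp_index|)%N;
  lp_on_sphere : forall i t, sphere2 (lp_curve i t);
  lp_closed : forall i, periodic (lp_curve i) 1;
  lp_derivable : forall i t, derivable (lp_curve i) t 1;
  lp_C1 : forall i, continuous (derive1 (lp_curve i));
  lp_immersion : forall i t, derive1 (lp_curve i) t != 0;
  lp_double : forall p u v w, preimages lp_curve p u ->
    preimages lp_curve p v -> preimages lp_curve p w ->
    [\/ u = v, v = w | u = w];
  lp_transverse : forall p u v, preimages lp_curve p u ->
    preimages lp_curve p v -> u <> v ->
    row_free (col_mx (derive1 (lp_curve u.1) u.2) (derive1 (lp_curve v.1) v.2))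
}.

Section LinkProjection.
Context {R : realType} (L : link_projection R).
Implicit Types (U V : set 'rV[R]_3) (W : set (set 'rV[R]_3)).

Definition projection_image : set 'rV[R]_3 :=
  [set p | exists i t, lp_curve (l := L) i t = p].

Definition crossings : set 'rV[R]_3 :=
  [set p | exists u v, [/\ preimages (lp_curve (l := L)) p u,
                           preimages (lp_curve (l := L)) p v & u <> v]].

Definition regions : set (set 'rV[R]_3) :=
  connected_component (sphere2 `\` projection_image)
    @` (sphere2 `\` projection_image).

(* The boundary of U in S^2, not in the ambient R^3. *)
Definition boundary U : set 'rV[R]_3 :=
  closure U `&` closure (sphere2 `\` U).

Definition regions_connected U V : Prop :=
  exists2 p, crossings p & boundary U p /\ boundary V p.

Definition isolated W : Prop :=
  W `<=` regions /\
  forall U V, W U -> W V -> U <> V -> ~ regions_connected U V.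

(* A link projection has finitely many regions, hence the finitely supported sum
   ranges over all isolated sets and each of them is finite. *)
Definition I_generating_function : {poly rat} :=
  \sum_(W \in [set W | isolated W]) ('X^(#|` fset_set W|)%fset : {poly rat}).

End LinkProjection.

Section Torus.
Context {R : realType}.
Implicit Types (s t x y : R).

Definition spherical x y : 'rV[R]_3 :=
  \row_(j < 3) [:: cos y * cos x; cos y * sin x; sin y]`_j.

(* The standard closed 2-braid sigma_1^n, drawn around the equator: at longitude
   x its two strands are at latitudes sin (n x / 2) and - sin (n x / 2), so they
   cross exactly n times. For n even, gcd(2, n) = 2 and each strand closes up
   after one turn (x runs through an interval of length 2 pi); for n odd,
   gcd(2, n) = 1 and there is one curve, closing up after two turns. *)
Definition torus_longitude n t : R := 4 * pi / (gcdn 2 n)%:R * t.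

Definition torus_latitude n (i : 'I_(gcdn 2 n)) t : R :=
  (-1) ^+ i * sin (n%:R / 2 * torus_longitude n t).

Definition torus_curve n (i : 'I_(gcdn 2 n)) t : 'rV[R]_3 :=
  spherical (torus_longitude n t) (torus_latitude i t).


Let d n : R := (gcdn 2 n)%:R.
Let a n : R := n%:R / 2 * (4 * pi / d n).

Lemma spherical0 x y : spherical x y 0 0 = cos y * cos x.
Proof. by rewrite mxE. Qed.
Lemma spherical1 x y : spherical x y 0 1 = cos y * sin x.
Proof. by rewrite mxE. Qed.
Lemma spherical2 x y : spherical x y 0 2 = sin y.
Proof. by rewrite mxE. Qed.

Lemma row3P (u v : 'rV[R]_3) :
  u 0 0 = v 0 0 -> u 0 1 = v 0 1 -> u 0 2 = v 0 2 -> u = v.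
Proof.
move=> h0 h1 h2; apply/rowP => -[[|[|[|//]]] lt_j].
- by rewrite (_ : Ordinal _ = 0) //; exact: val_inj.
- by rewrite (_ : Ordinal _ = 1) //; exact: val_inj.
- by rewrite (_ : Ordinal _ = 2) //; exact: val_inj.
Qed.

Lemma spherical_on_sphere x y : sphere2 (spherical x y).
Proof.
rewrite /sphere2 /= !big_ord_recl big_ord0 !mxE /=.
have := cos2Dsin2 x; have := cos2Dsin2 y.
set cy := cos y; set sy := sin y; set cx := cos x; set sx := sin x => hy hx.
transitivity (cy ^+ 2 * (cx ^+ 2 + sx ^+ 2) + sy ^+ 2); first by ring.
by rewrite hx mulr1.
Qed.

Lemma one_lt_pihalf : (1 : R) < pi / 2.
Proof.
rewrite lt_neqAle pihalf_ge1 andbT; apply/eqP => h1.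
by have := @cos1_gt0 R; rewrite h1 cos_pihalf ltxx.
Qed.

Lemma spherical_inj x y x' y' : -1 <= y <= 1 -> -1 <= y' <= 1 ->
  spherical x y = spherical x' y' -> [/\ y = y', cos x = cos x' & sin x = sin x'].
Proof.
move=> hy hy' e; have pih := one_lt_pihalf.
have yy' : y = y'.
  apply: sin_inj; rewrite ?in_itv /=; [lra|lra|].
  by have := congr1 (fun M : 'rV[R]_3 => M 0 2) e; rewrite !spherical2.
have cy : cos y != 0.
  by rewrite lt0r_neq0// cos_gt0_pihalf//; lra.
subst y'; split => //; apply: (mulfI cy).
- by have := congr1 (fun M : 'rV[R]_3 => M 0 0) e; rewrite !spherical0.
- by have := congr1 (fun M : 'rV[R]_3 => M 0 1) e; rewrite !spherical1.
Qed.

Lemma gcd2_case n : {gcdn 2 n = 1%N /\ odd n} + {gcdn 2 n = 2%N /\ ~~ odd n}.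
Proof.
case: (boolP (odd n)) => on; [left|right]; split => //.
- by apply/eqP; rewrite -/(coprime 2 n) coprime2n.
- by apply/gcdn_idPl; rewrite dvdn2.
Qed.

Lemma d_gt0 n : 0 < d n.
Proof. by rewrite /d ltr0n gcdn_gt0. Qed.

Lemma a_gt0 n : (0 < n)%N -> 0 < a n.
Proof.
move=> n0; rewrite /a mulr_gt0// divr_gt0// ?ltr0n//.
  by rewrite mulr_gt0// pi_gt0.
by rewrite gcdn_gt0.
Qed.

Lemma cos_eq1 x : 0 <= x < pi *+ 2 -> cos x = 1 -> x = 0.
Proof.
move=> /andP[x0 x2] cx; have pi0 := @pi_gt0 R.
have [xpi|xpi] := leP x pi.
  by apply: cos_inj; rewrite ?in_itv /= ?cos0 ?x0 ?lexx //= ltW.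
suff : pi *+ 2 - x = 0 by move=> h; lra.
apply: cos_inj; rewrite ?in_itv /= ?lexx ?(ltW pi0) //.
  by rewrite subr_ge0 ltW//=; lra.
by rewrite cosB cos2pi sin2pi cx cos0 mul0r addr0 mulr1.
Qed.

Let S n (u : 'I_(gcdn 2 n) * R) := (-1) ^+ u.1 * sin (a n * u.2).
Let K n (u : 'I_(gcdn 2 n) * R) := (-1) ^+ u.1 * cos (a n * u.2).

Lemma strand_sign n (u v : 'I_(gcdn 2 n) * R) : (0 < n)%N ->
  0 <= u.2 < 1 -> 0 <= v.2 < 1 ->
  cos (torus_longitude n u.2) = cos (torus_longitude n v.2) ->
  sin (torus_longitude n u.2) = sin (torus_longitude n v.2) ->
  u = v \/ (S v = - S u /\ K v = - K u).
Proof.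
move=> n0; wlog uv : u v / u.2 <= v.2.
  move=> wl hu hv hc hs; have [uv|/ltW vu] := leP u.2 v.2; first exact: wl.
  have [->|[h1 h2]] := wl v u vu hv hu (esym hc) (esym hs); first by left.
  by right; rewrite h1 h2 !opprK.
move: u v uv => [i s] [j t] /= st /andP[s0 s1] /andP[t0 t1] hc hs.
have pi0 := @pi_gt0 R.
pose D := torus_longitude n t - torus_longitude n s.
have DE : D = 4 * pi / d n * (t - s) by rewrite /D /torus_longitude mulrBr.
have cD : cos D = 1.
  by rewrite /D cosB hc hs -!expr2 cos2Dsin2.
have aD : a n * t = a n * s + n%:R / 2 * D.
  by rewrite DE /a; ring.
have D0 : 0 <= D.
  by rewrite DE mulr_ge0 ?subr_ge0// divr_ge0 ?ler0n// mulr_ge0 ?ler0n ?ltW.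
have ts : D = 0 -> s = t.
  have c0 : 0 < 4 * pi / d n by rewrite divr_gt0 ?d_gt0// mulr_gt0.
  by rewrite DE => /eqP; rewrite mulf_eq0 gt_eqF//= subr_eq0 => /eqP->.
have ltk m k (l : 'I_m) : m = k -> (l < k)%N by move=> <-.
have [[dE on]|[dE en]] := gcd2_case n.
- have ij : i = j.
    apply: val_inj => /=; move: (ltk _ _ i dE) (ltk _ _ j dE).
    by case: (i : nat) (j : nat) => [|?] [|?].
  subst j; have D4 : D < pi *+ 4.
    have -> : D = 4 * pi * (t - s) by rewrite DE /d dE divr1.
    have : 0 < 4 * pi * (1 - (t - s)) by rewrite !mulr_gt0//; lra.
    lra.
  have [D2|D2] := ltP D (pi *+ 2).
    by left; rewrite (ts (cos_eq1 _ cD))// D0.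
  have DD : D = pi *+ 2.
    apply/eqP; rewrite -subr_eq0; apply/eqP/cos_eq1.
      by apply/andP; split; lra.
    by rewrite cosB cos2pi sin2pi cD mulr1 mulr0 addr0.
  have aE : a n * t = a n * s + pi *+ n.
    by rewrite aD DD -[pi *+ n]mulr_natl -[pi *+ 2]mulr_natl; field.
  right; rewrite /S /K /= aE (alternatingn (@sinDpi R)) (alternatingn (@cosDpi R)).
  have -> : (-1) ^+ n = -1 :> R by rewrite -signr_odd on.
  by rewrite !mulN1r !mulrN.
- have D2 : D < pi *+ 2.
    have -> : D = 2 * pi * (t - s) by rewrite DE /d dE; field.
    have : 0 < 2 * pi * (1 - (t - s)) by rewrite !mulr_gt0//; lra.
    lra.
  have D00 : D = 0 by apply: cos_eq1 => //; rewrite D0.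
  have st' := ts D00; subst t.
  have [<-|ij] := eqVneq i j; [by left|right; rewrite /S /K /=].
  have -> : (-1) ^+ j = - (-1) ^+ i :> R.
    move: ij (ltk _ _ i dE) (ltk _ _ j dE); rewrite -val_eqE /=.
    case: (i : nat) (j : nat) => [|[|?]] [|[|?]]//= _ _ _.
    by rewrite opprK.
  by rewrite !mulNr.
Qed.

Let SE n (u : 'I_(gcdn 2 n) * R) : torus_latitude u.1 u.2 = S u.
Proof. by rewrite /torus_latitude /S /a /torus_longitude mulrA. Qed.

Let Sle1 n (u : 'I_(gcdn 2 n) * R) : -1 <= S u <= 1.
Proof. by rewrite -ler_norml normrM normrX normrN1 expr1n mul1r sin_max. Qed.

Let SK n (u : 'I_(gcdn 2 n) * R) : S u ^+ 2 + K u ^+ 2 = 1.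
Proof.
by rewrite /S /K !exprMn -!exprM mulnC exprM sqrrN !expr1n !mul1r addrC cos2Dsin2.
Qed.

Lemma torus_double_point n p (u v : 'I_(gcdn 2 n) * R) : (0 < n)%N ->
  preimages (@torus_curve n) p u -> preimages (@torus_curve n) p v ->
  u <> v ->
  [/\ S u = 0, S v = 0, K v = - K u,
     cos (torus_longitude n u.2) = cos (torus_longitude n v.2) &
     sin (torus_longitude n u.2) = sin (torus_longitude n v.2)].
Proof.
move=> n0 [hu <-] [hv /esym e] uv.
move: e; rewrite /torus_curve !SE => /(spherical_inj (Sle1 u) (Sle1 v)) [e hc hs].
have [//|[h1 h2]] := strand_sign n0 hu hv hc hs.
by split => //; lra.
Qed.

Lemma torus_double n : (0 < n)%N -> forall p u v w,
  preimages (@torus_curve n) p u -> preimages (@torus_curve n) p v ->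
  preimages (@torus_curve n) p w -> [\/ u = v, v = w | u = w].
Proof.
move=> n0 p u v w hu hv hw.
have [->|/eqP uv] := eqVneq u v; first exact: Or31.
have [->|/eqP vw] := eqVneq v w; first exact: Or32.
have [->|/eqP uw] := eqVneq u w; first exact: Or33.
have [Su _ Kuv _ _] := torus_double_point n0 hu hv uv.
have [_ _ Kvw _ _] := torus_double_point n0 hv hw vw.
have [_ _ Kuw _ _] := torus_double_point n0 hu hw uw.
have K0 : K u = 0 by lra.
by have := SK u; rewrite Su K0 expr0n addr0 => /eqP; rewrite eq_sym oner_eq0.
Qed.

Lemma torus_closed n (i : 'I_(gcdn 2 n)) : periodic (@torus_curve n i) 1.
Proof.
move=> t; rewrite /torus_curve /torus_latitude.
have E x k : cos (x + pi *+ (2 * k)) = cos x /\ sin (x + pi *+ (2 * k)) = sin x.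
  by rewrite mulrnA; split; [apply: (periodicn (@cosD2pi R))|apply: (periodicn (@sinD2pi R))].
have [h [k [h1 h2]]] : exists h k : nat,
    torus_longitude n (t + 1) = torus_longitude n t + pi *+ (2 * h) /\
    n%:R / 2 * torus_longitude n (t + 1) =
      n%:R / 2 * torus_longitude n t + pi *+ (2 * k).
  rewrite /torus_longitude; have [[-> on]|[-> en]] := gcd2_case n.
    by exists 2, n; rewrite -!(mulr_natl pi) !natrM; split; field.
  have ne : n = (n./2 * 2)%N by rewrite muln2 -{1}(odd_double_half n) (negbTE en).
  have nR : n%:R = n./2%:R * 2 :> R by rewrite {1}ne natrM.
  by exists 1, n./2; rewrite -!(mulr_natl pi) nR !natrM; split; field.
by rewrite h2 h1 (E _ k).2 /spherical (E _ h).1 (E _ h).2.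
Qed.

Let vel n (u : 'I_(gcdn 2 n) * R) : 'rV[R]_3 :=
  let c := 4 * pi / d n in let th := torus_longitude n u.2 in
  \row_(j < 3) [:: - (sin (S u) * (a n * K u)) * cos th - cos (S u) * (c * sin th);
                   - (sin (S u) * (a n * K u)) * sin th + cos (S u) * (c * cos th);
                   cos (S u) * (a n * K u)]`_j.

Let is_derive_lin (c t : R) : is_derive t 1 (fun s : R => c * s) c.
Proof.
have h := @is_deriveZ R R R id c t 1 1 (is_derive_id t 1).
by apply: (is_derive_eq h); rewrite scaler1.
Qed.

Let is_derive_S n (i : 'I_(gcdn 2 n)) t :
  is_derive t 1 (fun s => S (i, s)) (a n * K (i, t)).
Proof.
have h : is_derive t 1 (fun s => sin (a n * s)) (cos (a n * t) * a n).
  exact: (is_derive1_comp (is_derive_sin _) (is_derive_lin (a n) t)).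
have h' := is_deriveZ ((-1) ^+ i) h.
by apply: (is_derive_eq h'); rewrite /K /= /GRing.scale /=; ring.
Qed.

Let is_derive_K n (i : 'I_(gcdn 2 n)) t :
  is_derive t 1 (fun s => K (i, s)) (- (a n * S (i, t))).
Proof.
have h : is_derive t 1 (fun s => cos (a n * s)) (- sin (a n * t) * a n).
  exact: (is_derive1_comp (is_derive_cos _) (is_derive_lin (a n) t)).
have h' := is_deriveZ ((-1) ^+ i) h.
by apply: (is_derive_eq h'); rewrite /S /= /GRing.scale /=; ring.
Qed.

Lemma torus_curveE n (i : 'I_(gcdn 2 n)) t :
  torus_curve i t = spherical (torus_longitude n t) (S (i, t)).
Proof. by rewrite /torus_curve -SE. Qed.

Let is_derive_coslong n t :
  is_derive t 1 (fun s => cos (torus_longitude n s))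
    (- sin (torus_longitude n t) * (4 * pi / d n)).
Proof. exact: (is_derive1_comp (is_derive_cos _) (is_derive_lin _ t)). Qed.

Let is_derive_sinlong n t :
  is_derive t 1 (fun s => sin (torus_longitude n s))
    (cos (torus_longitude n t) * (4 * pi / d n)).
Proof. exact: (is_derive1_comp (is_derive_sin _) (is_derive_lin _ t)). Qed.

Let is_derive_cosS n (i : 'I_(gcdn 2 n)) t :
  is_derive t 1 (fun s => cos (S (i, s))) (- sin (S (i, t)) * (a n * K (i, t))).
Proof. exact: (is_derive1_comp (is_derive_cos _) (is_derive_S i t)). Qed.

Let is_derive_sinS n (i : 'I_(gcdn 2 n)) t :
  is_derive t 1 (fun s => sin (S (i, s))) (cos (S (i, t)) * (a n * K (i, t))).
Proof. exact: (is_derive1_comp (is_derive_sin _) (is_derive_S i t)). Qed.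

Lemma torus_curve_is_derive n (i : 'I_(gcdn 2 n)) t :
  is_derive t 1 (torus_curve i) (vel (i, t)).
Proof.
set c := 4 * pi / d n.
have hc := is_derive_coslong n t; have hs := is_derive_sinlong n t.
have hC := is_derive_cosS i t; have hS := is_derive_sinS i t.
have hCc := is_deriveM hC hc; have hCs := is_deriveM hC hs.
have h (k : 'I_1) (j : 'I_3) :
    is_derive t 1 (fun s => torus_curve i s k j) (vel (i, t) k j).
  rewrite (ord1 k); case: j => -[|[|[|//]]] lt_j.
  - have -> : (fun s => torus_curve i s 0 (Ordinal lt_j)) =
        (fun s => cos (S (i, s))) * (fun s => cos (torus_longitude n s)).
      by apply/funext => s; rewrite torus_curveE mxE.
    apply: (is_derive_eq hCc); rewrite mxE /= /GRing.scale /= -/c; ring.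
  - have -> : (fun s => torus_curve i s 0 (Ordinal lt_j)) =
        (fun s => cos (S (i, s))) * (fun s => sin (torus_longitude n s)).
      by apply/funext => s; rewrite torus_curveE mxE.
    apply: (is_derive_eq hCs); rewrite mxE /= /GRing.scale /= -/c; ring.
  - have -> : (fun s => torus_curve i s 0 (Ordinal lt_j)) =
        (fun s => sin (S (i, s))).
      by apply/funext => s; rewrite torus_curveE mxE.
    by apply: (is_derive_eq hS); rewrite mxE.
have dv : derivable (torus_curve i) t 1.
  by apply/derivable_mxP => k j; apply: ex_derive; exact: h.
apply: DeriveDef => //; rewrite derive_mx//.
by apply/matrixP => k j; rewrite mxE; apply: derive_val; exact: h.
Qed.

Lemma torus_velocity n (i : 'I_(gcdn 2 n)) t :
  derive1 (torus_curve i) t = vel (i, t).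
Proof.
by rewrite derive1E; apply: derive_val; exact: torus_curve_is_derive.
Qed.

Lemma torus_derivable n (i : 'I_(gcdn 2 n)) t : derivable (torus_curve i) t 1.
Proof. by apply: ex_derive; exact: torus_curve_is_derive. Qed.

Let vel_derivable n (i : 'I_(gcdn 2 n)) (t : R) :
  derivable (fun s : R => vel (i, s)) t 1.
Proof.
have dK := @ex_derive _ _ _ _ _ _ _ (is_derive_K i t).
have dc := @ex_derive _ _ _ _ _ _ _ (is_derive_coslong n t).
have ds := @ex_derive _ _ _ _ _ _ _ (is_derive_sinlong n t).
have dC := @ex_derive _ _ _ _ _ _ _ (is_derive_cosS i t).
have dS := @ex_derive _ _ _ _ _ _ _ (is_derive_sinS i t).
have dcst (x : R) : derivable (cst x) t 1 by exact: derivable_cst.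
apply/(derivable_mxP (fun s : R => vel (i, s)) t 1).
move=> k j; rewrite (ord1 k).
case: j => -[|[|[|j]]] lt_j; last by exfalso; move: lt_j.
- have -> : (fun s => vel (i, s) 0 (Ordinal lt_j)) =
      - ((fun s => sin (S (i, s))) * (cst (a n) * (fun s => K (i, s)))) *
        (fun s => cos (torus_longitude n s)) -
      (fun s => cos (S (i, s))) *
        (cst (4 * pi / d n) * (fun s => sin (torus_longitude n s))).
    by apply/funext => s; rewrite mxE.
  exact: (derivableB (derivableM (derivableN (derivableM dS (derivableM (dcst _) dK))) dc)
    (derivableM dC (derivableM (dcst _) ds))).
- have -> : (fun s => vel (i, s) 0 (Ordinal lt_j)) =
      - ((fun s => sin (S (i, s))) * (cst (a n) * (fun s => K (i, s)))) *
        (fun s => sin (torus_longitude n s)) +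
      (fun s => cos (S (i, s))) *
        (cst (4 * pi / d n) * (fun s => cos (torus_longitude n s))).
    by apply/funext => s; rewrite mxE.
  exact: (derivableD (derivableM (derivableN (derivableM dS (derivableM (dcst _) dK))) ds)
    (derivableM dC (derivableM (dcst _) dc))).
- have -> : (fun s => vel (i, s) 0 (Ordinal lt_j)) =
      (fun s => cos (S (i, s))) * (cst (a n) * (fun s => K (i, s))).
    by apply/funext => s; rewrite mxE.
  exact: (derivableM dC (derivableM (dcst _) dK)).
Qed.

Lemma torus_C1 n (i : 'I_(gcdn 2 n)) : continuous (derive1 (torus_curve i)).
Proof.
have -> : derive1 (torus_curve i) = (fun t => vel (i, t)).
  by apply/funext => t; rewrite torus_velocity.
move=> t; apply/differentiable_continuous/derivable1_diffP.
exact: vel_derivable.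
Qed.

Lemma vel0 n u : @vel n u 0 0 = - (sin (S u) * (a n * K u)) *
  cos (torus_longitude n u.2) - cos (S u) * (4 * pi / d n * sin (torus_longitude n u.2)).
Proof. by rewrite mxE. Qed.
Lemma vel1 n u : @vel n u 0 1 = - (sin (S u) * (a n * K u)) *
  sin (torus_longitude n u.2) + cos (S u) * (4 * pi / d n * cos (torus_longitude n u.2)).
Proof. by rewrite mxE. Qed.
Lemma vel2 n u : @vel n u 0 2 = cos (S u) * (a n * K u).
Proof. by rewrite mxE. Qed.

Let c_gt0 n : 0 < 4 * pi / d n.
Proof. by rewrite divr_gt0 ?d_gt0// mulr_gt0// pi_gt0. Qed.

Let no_dir x y : y * sin x = 0 -> y * cos x = 0 -> y = 0.
Proof.
move=> hs hc; have := cos2Dsin2 x => h.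
rewrite -[y]mulr1 -h mulrDr !expr2 !mulrA hs hc !mul0r addr0//.
Qed.

Lemma torus_immersion n (i : 'I_(gcdn 2 n)) t : (0 < n)%N ->
  derive1 (torus_curve i) t != 0.
Proof.
move=> n0; rewrite torus_velocity; apply/eqP => v0.
have cS : 0 < cos (S (i, t)).
  have /andP[h1 h2] := Sle1 (i, t); have h3 := one_lt_pihalf.
  by apply: cos_gt0_pihalf; apply/andP; split; lra.
have aK : a n * K (i, t) = 0.
  have := congr1 (fun M : 'rV[R]_3 => M 0 2) v0; rewrite vel2 mxE => /eqP.
  by rewrite mulf_eq0 gt_eqF//= => /eqP.
have := congr1 (fun M : 'rV[R]_3 => M 0 1) v0.
have := congr1 (fun M : 'rV[R]_3 => M 0 0) v0.
rewrite vel0 vel1 aK !mxE mulr0 oppr0 !mul0r sub0r add0r => /eqP.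
rewrite oppr_eq0 mulrA => /eqP h1; rewrite mulrA => h2.
by have /eqP := no_dir h1 h2; rewrite gt_eqF// mulr_gt0.
Qed.

Lemma torus_transverse n : (0 < n)%N -> forall p u v,
  preimages (@torus_curve n) p u -> preimages (@torus_curve n) p v -> u <> v ->
  row_free (col_mx (derive1 (torus_curve u.1) u.2) (derive1 (torus_curve v.1) v.2)).
Proof.
move=> n0 p u v hu hv uv.
have [Su Sv Kv hc hs] := torus_double_point n0 hu hv uv.
rewrite !torus_velocity -!surjective_pairing.
apply: (@inj_row_free _ (1 + 1)) => w; rewrite -[w]hsubmxK mul_row_col => e.
set x := lsubmx w 0 0; set y := rsubmx w 0 0.
have {}e j : x * vel u 0 j + y * vel v 0 j = 0.
  have := congr1 (fun M : 'rV[R]_3 => M 0 j) e.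
  by rewrite [LHS]mxE [X in X + _]mxE [X in _ + X]mxE !big_ord1 [RHS]mxE.
have [h0 h1 h2] := And3 (e 0) (e 1) (e 2).
move: h0 h1 h2; rewrite !vel0 !vel1 !vel2 Su Sv sin0 cos0 Kv hc hs.
set cx := cos _; set sx := sin _ => h0 h1 h2.
have xy : x + y = 0.
  have c0 := c_gt0 n; set c := 4 * pi / d n in c0 h0 h1.
  have : c * (x + y) = 0.
    by apply: (@no_dir (torus_longitude n v.2)); rewrite -/cx -/sx; lra.
  by move=> /eqP; rewrite mulf_eq0 gt_eqF//= => /eqP.
have xy' : x - y = 0.
  have K0 : K u != 0.
    apply/eqP => K0; have := SK u; rewrite Su K0 expr0n addr0 => /eqP.
    by rewrite eq_sym oner_eq0.
  by apply: (mulfI (mulf_neq0 (lt0r_neq0 (a_gt0 n0)) K0)); rewrite mulr0; lra.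
have [x0 y0] : x = 0 /\ y = 0 by split; lra.
have -> : lsubmx w = 0 by apply/matrixP => k l; rewrite (ord1 k) (ord1 l) [RHS]mxE.
have -> : rsubmx w = 0 by apply/matrixP => k l; rewrite (ord1 k) (ord1 l) [RHS]mxE.
exact: row_mx0.
Qed.

Lemma torus_nonempty n : (0 < #|'I_(gcdn 2 n)|)%N.
Proof. by rewrite card_ord gcdn_gt0. Qed.

Definition torus_projection n (n_gt0 : (0 < n)%N) : link_projection R :=
  @LinkProjection R 'I_(gcdn 2 n) (@torus_curve n) (torus_nonempty n)
    (fun i t => spherical_on_sphere _ _) (@torus_closed n) (@torus_derivable n)
    (@torus_C1 n) (fun i t => torus_immersion i t n_gt0)
    (torus_double n_gt0) (torus_transverse n_gt0).
End Torus.

(* Main.v *)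
Require Import Defs.
From mathcomp Require Import all_boot all_order all_algebra finmap.
From mathcomp Require Import all_classical all_reals all_analysis.
From mathcomp Require Import ring lra zify.

(** Cut open along a meridian, the sphere becomes a rectangle: the points of
    S^2 are [chart (s, y)] with [0 <= s <= n] (the longitude, rescaled so that
    the crossings have integral [s]) and [- pi / 2 <= y <= pi / 2] (the
    latitude). In this chart the projection is the pair of graphs
    [y = height s] and [y = - height s] with [height s = `|sin (pi * s)|]
    ([torus_projectionP]), and its complement is visibly made of [n + 2] faces:
    the polar caps [height s < y] and [y < - height s], and, for [k < n], the
    bigon [`|y| < height s], [k < s < k + 1].

    These faces are the regions ([regions_range]). Each is connected because any
    of its points is joined to its center by a vertical then a horizontal
    segment ([connected_hook]). No region is larger than a face, because a face
    is relatively open and closed in the complement: both facts amount to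
    certain sets being closed in the sphere, and these are images under [chart]
    of closed subsets of the compact rectangle ([chart_closed]). The latter
    device also bounds the closure of a bigon, so the crossings on its boundary
    are its two tips, whereas all crossings are on the boundary of both caps
    ([boundary_region]). Hence two regions are connected unless they are bigons
    that are not consecutive ([regions_connectedP]), and the isolated sets of
    regions correspond to the sets of face labels without linked pair
    ([isolated_bij]).

    It remains to count the latter. A cap is linked to everything, so it only
    occurs alone, which accounts for [2 x]; the other sets are the subsets of
    the cycle of length [n] without two consecutive elements. Written as cyclic
    words of bits they are counted by a transfer recursion ([path_polyS]): the
    generating functions [F m] of the words of length [m] on a path satisfy
    [F (m + 2) = F (m + 1) + x F m], hence have the coefficients
    [C(m + 1 - k, k)] ([coef_path_poly]), and splitting on the first bit turns a
    cycle into paths ([cycle_sum]). The coefficient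
    [C(n - k, k) + C(n - k - 1, k - 1)] thus found is
    [C(n - k, k) n / (n - k)] ([cycle_count]). *)

Set Implicit Arguments.
Unset Strict Implicit.
Unset Printing Implicit Defensive.

Import Order.TTheory GRing.Theory Num.Theory.
Import numFieldNormedType.Exports.
Local Open Scope ring_scope.

(** * Sparse subsets of a cycle *)

Definition not_both (a b : bool) := ~~ (a && b).

(** The words on a path whose left and right neighbours are the fixed bits [a]
    and [c]; keeping both ends as parameters is what closes the recursion. *)
Definition path_poly (a c : bool) (m : nat) : {poly rat} :=
  \sum_(t : m.-tuple bool | path not_both a (rcons t c)) 'X^(count id t).

Lemma big_tuple_cons (m : nat) (P : pred (seq bool))
    (F : seq bool -> {poly rat}) :
  \sum_(t : m.+1.-tuple bool | P t) F t =
  \sum_(t : m.-tuple bool | P (false :: t)) F (false :: t) +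
  \sum_(t : m.-tuple bool | P (true :: t)) F (true :: t).
Proof.
rewrite (reindex (fun u : bool * m.-tuple bool => [tuple of u.1 :: u.2])) /=.
  rewrite -(pair_big_dep xpredT (fun b (t : m.-tuple bool) => P (b :: t))
    (fun b (t : m.-tuple bool) => F (b :: t))) /=.
  by rewrite big_bool addrC.
exists (fun t => (thead t, [tuple of behead t])) => [[b t] _|t _] /=.
  by rewrite theadE; congr (_, _); apply: val_inj.
by rewrite -tuple_eta.
Qed.

Lemma path_poly0 a c : path_poly a c 0 = (not_both a c)%:R.
Proof.
rewrite /path_poly big_mkcond /= (eq_bigr (fun=> (not_both a c)%:R)).
  by rewrite big_const card_tuple expn0 /= addr0.
by move=> t _; rewrite (tuple0 t) /= andbT expr0; case: (not_both a c).
Qed.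

Lemma path_polyS a c m : path_poly a c m.+1 =
  path_poly false c m + (if a then 0 else 'X * path_poly true c m).
Proof.
rewrite /path_poly (big_tuple_cons m (fun t => path not_both a (rcons t c))
  (fun t => 'X^(count id t))) /=.
case: a => /=; congr (_ + _); first by rewrite big_pred0.
by rewrite mulr_sumr; apply: eq_bigr => t _; rewrite exprD expr1.
Qed.

Lemma path_poly_rec a m :
  path_poly false a m.+2 = path_poly false a m.+1 + 'X * path_poly false a m.
Proof. by rewrite path_polyS [path_poly true a m.+1]path_polyS addr0. Qed.

Lemma eq_from_path_rec (u v : nat -> {poly rat}) :
  u 0 = v 0 -> u 1 = v 1 ->
  (forall m, u m.+2 = u m.+1 + 'X * u m) ->
  (forall m, v m.+2 = v m.+1 + 'X * v m) ->
  u =1 v.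
Proof.
move=> h0 h1 hu hv m; suff [] : u m = v m /\ u m.+1 = v m.+1 by [].
by elim: m => [|m [IH IH1]] //; rewrite hu hv IH IH1.
Qed.

(** A set bit at the right end forces the last bit of the word to be unset. By
    symmetry this is [path_polyS] with [a = true]; both sides satisfy the
    Fibonacci recursion, which spares reversing words. *)
Lemma path_polyS_blocked m :
  path_poly false true m.+1 = path_poly false false m.
Proof.
move: m; apply: eq_from_path_rec => [||m|m]; rewrite ?path_poly_rec //.
  by rewrite path_polyS !path_poly0 mulr0 addr0.
by rewrite !path_polyS !path_poly0 mulr0 addr0.
Qed.

(** Pascal's rule is the Fibonacci recursion read along the diagonals. Truncated
    subtraction is harmless: for [k > m + 1] both sides are zero. *)
Lemma coef_path_poly m k :
  (path_poly false false m)`_k = 'C(m.+1 - k, k)%:R.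
Proof.
suff [] : (forall k, (path_poly false false m)`_k = 'C(m.+1 - k, k)%:R) /\
  (forall k, (path_poly false false m.+1)`_k = 'C(m.+2 - k, k)%:R) by [].
elim: m {k} => [|m [IH IH1]].
  split=> k; rewrite ?path_polyS !path_poly0 /=.
    by rewrite coefC; case: k => [|[|k]].
  by rewrite mulr1 coefD coef1 coefX; case: k => [|[|[|k]]].
split=> // -[|k]; rewrite path_poly_rec coefD coefXM /= IH1.
  by rewrite !subn0 !bin0 addr0.
rewrite IH -natrD; congr _%:R; have [km|mk] := leqP k m.+1.
  by rewrite !subSS (subSn km) binS.
by rewrite !bin_small //; lia.
Qed.

(** If the first bit is unset, the others form a path of length [n - 1] with
    free ends; if it is set, its two neighbours are unset and the others form a
    path of length [n - 3]. *)
Lemma cycle_sum n : (3 <= n)%N ->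
  \sum_(t : n.-tuple bool | cycle not_both t) 'X^(count id t) =
  path_poly false false n.-1 + 'X * path_poly false false (n - 3).
Proof.
case: n => [|[|[|m]]] // _; rewrite !subSS subn0 /=.
rewrite (big_tuple_cons m.+2 (cycle not_both) (fun t => 'X^(count id t))) /=.
congr (_ + _); rewrite -path_polyS_blocked.
transitivity ('X * path_poly true true m.+2); last by rewrite path_polyS addr0.
by rewrite mulr_sumr; apply: eq_bigr => t _; rewrite exprD expr1.
Qed.

Definition cyclically_sparse n (B : {set 'I_n}) :=
  [forall i in B, ordS i \notin B].

Lemma cycle_tnthP n (t : n.-tuple bool) : (0 < n)%N ->
  reflect (forall i, not_both (tnth t i) (tnth t (ordS i))) (cycle not_both t).
Proof.
case: n t => // m t _; set s := behead t.
have st : tval t = thead t :: s by rewrite {1}(tuple_eta t).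
have ss : size s = m by rewrite size_behead size_tuple.
have -> : cycle not_both t = path not_both (thead t) (rcons s (thead t)).
  by rewrite {1}st.
apply: (iffP (pathP false)).
  move=> h i; have := h i; rewrite size_rcons ss => /(_ (ltn_ord i)).
  rewrite -rcons_cons nth_rcons /= ss ltn_ord -st -(tnth_nth false t).
  congr not_both; rewrite nth_rcons ss (tnth_nth false) st /=.
  have [im|im|im] := ltngtP i m.
  - by rewrite modn_small.
  - by have := ltn_ord i; rewrite ltnS leqNgt im.
  - by rewrite im modnn.
move=> h i; rewrite size_rcons ss => im.
have := h (Ordinal im); rewrite !(tnth_nth false) /= st.
rewrite -rcons_cons nth_rcons /= ss im; congr not_both.
rewrite nth_rcons ss; have [im'|im'|->] := ltngtP i m.
- by rewrite modn_small.
- by move: im; rewrite ltnS leqNgt im'.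
- by rewrite modnn.
Qed.

Lemma sum_sparse_cycle n : (0 < n)%N ->
  \sum_(B : {set 'I_n} | cyclically_sparse B) 'X^#|B| =
  \sum_(t : n.-tuple bool | cycle not_both t) 'X^(count id t) :> {poly rat}.
Proof.
move=> n0.
rewrite (reindex (fun t : n.-tuple bool => [set i | tnth t i])) /=.
  apply: eq_big => t.
    apply/forall_inP/(cycle_tnthP t n0) => h i; have := h i;
      rewrite !inE /not_both.
      by case: (tnth t i) => //= ->.
    by move=> + ti; rewrite ti.
  move=> _; congr ('X^_); rewrite cardsE cardE /enum_mem size_filter.
  rewrite -[in RHS](map_tnth_enum t) count_map -enumT.
  by apply: eq_count.
exists (fun B : {set 'I_n} => [tuple i \in B | i < n]) => [t _|B _] /=.
  by apply: eq_from_tnth => i; rewrite tnth_mktuple inE.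
by apply/setP => i; rewrite inE tnth_mktuple.
Qed.

(** The labels of the regions: [inl k] is the [k]-th bigon, [inr false] and
    [inr true] are the two caps. *)
Definition linked n (f g : 'I_n + bool) : bool :=
  match f, g with
  | inl i, inl j => (j == ordS i) || (i == ordS j)
  | _, _ => true
  end.

Definition unlinked_set n (A : {set 'I_n + bool}) :=
  [forall f in A, forall g in A, (f != g) ==> ~~ linked f g].

(** A cap is linked to all other regions, so it can only occur alone. *)
Lemma unlinked_cap n (A : {set 'I_n + bool}) b :
  unlinked_set A && (inr b \in A) = (A == [set inr b]).
Proof.
apply/andP/eqP => [[/forall_inP h bA]|->].
  apply/setP => f; rewrite inE; apply/idP/eqP => [fA|->//].
  apply/eqP; have /forall_inP/(_ _ bA) := h _ fA.
  by case: (f =P inr b) => //= _; case: f {fA}.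
split; last by rewrite inE.
apply/forall_inP => f; rewrite inE => /eqP->.
by apply/forall_inP => g; rewrite inE => /eqP->; rewrite eqxx.
Qed.

Lemma ordS_neq n (i : 'I_n) : (1 < n)%N -> ordS i != i.
Proof.
move=> n1; rewrite -val_eqE /=; have := ltn_ord i.
rewrite leq_eqVlt => /orP[/eqP e|lt]; last by rewrite modn_small// gtn_eqF.
by rewrite e modnn; lia.
Qed.

Lemma unlinked_bigons n (B : {set 'I_n}) : (1 < n)%N ->
  unlinked_set [set inl i | i in B] = cyclically_sparse B.
Proof.
move=> n1; apply/forall_inP/forall_inP => h.
  move=> i iB; apply/negP => jB.
  have /forall_inP/(_ _ (imset_f inl jB)) := h _ (imset_f inl iB).
  by rewrite /= eqxx /= implybF negbK => /eqP[] /esym/eqP; apply/negP/ordS_neq.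
move=> f /imsetP[i iB ->]; apply/forall_inP => g /imsetP[j jB ->] /=.
apply/implyP => _; apply/norP; split; apply/eqP => e.
  by have := h i iB; rewrite -e jB.
by have := h j jB; rewrite -e iB.
Qed.

Lemma sum_unlinked n : (1 < n)%N ->
  \sum_(A : {set 'I_n + bool} | unlinked_set A) 'X^#|A| =
  'X *+ 2 + \sum_(B : {set 'I_n} | cyclically_sparse B) 'X^#|B| :> {poly rat}.
Proof.
move=> n1.
rewrite (bigID (fun A : {set 'I_n + bool} => inr true \in A)) /=.
rewrite (big_pred1 [set inr true]); last by move=> A; rewrite /= unlinked_cap.
rewrite (bigID (fun A : {set 'I_n + bool} => inr false \in A)) /=.
rewrite (big_pred1 [set inr false]); last first.
  move=> A /=; rewrite andbAC unlinked_cap.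
  by case: eqP => [->|]; rewrite ?inE.
rewrite !cards1 expr1 addrA -mulr2n; congr (_ + _).
rewrite (reindex_onto (fun B : {set 'I_n} => [set inl i | i in B])
  (fun A : {set 'I_n + bool} => [set i | inl i \in A])) /=; last first.
  move=> A /andP[/andP[_ At] Af]; apply/setP => f; apply/imsetP/idP.
    by move=> [i + ->]; rewrite inE.
  case: f => [i iA|b bA]; first by exists i; rewrite ?inE.
  by case: b bA => h; [rewrite h in At|rewrite h in Af].
apply: eq_big => [B|B _]; last by rewrite card_imset//; exact: inl_inj.
rewrite unlinked_bigons//; set c := _ == B.
have -> : c by apply/eqP/setP => i; rewrite inE mem_imset //; exact: inl_inj.
have N b : (inr b \in [set (inl i : 'I_n + bool) | i in B]) = false.
  by apply/imsetP => -[].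
by rewrite !N !andbT.
Qed.

(** This is [k C(m, k) = m C(m - 1, k - 1)] with [m = n - k], after writing
    [n = m + k]. *)
Lemma cycle_count n k : (k <= n %/ 2)%N -> (0 < n)%N ->
  ('C(n - k, k) + (if k is j.+1 then 'C(n - 2 - j, j) else 0))%:R =
  'C(n - k, k)%:R * (n%:R / (n - k)%:R) :> rat.
Proof.
move=> kn n0; have kn' : (k * 2 <= n)%N by rewrite -leq_divRL.
case: k kn kn' => [|j] _ kn.
  by rewrite addn0 subn0 divff ?mulr1// pnatr_eq0; lia.
have -> : (n - 2 - j = (n - j.+1).-1)%N by lia.
have e := mul_bin_diag (n - j.+1) j.
have m0 : (0 < n - j.+1)%N by lia.
have -> : n%:R = (n - j.+1)%:R + j.+1%:R :> rat by rewrite -natrD subnK//; lia.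
have m0' : (n - j.+1)%:R != 0 :> rat by rewrite pnatr_eq0 -lt0n.
have e' : (n - j.+1)%:R * 'C((n - j.+1).-1, j)%:R =
    j.+1%:R * 'C(n - j.+1, j.+1)%:R :> rat.
  by rewrite -!natrM e.
by apply: (mulfI m0'); rewrite natrD mulrDr e'; field.
Qed.

Lemma sum_unlinked_closed n : (4 <= n)%N ->
  \sum_(A : {set 'I_n + bool} | unlinked_set A) 'X^#|A| =
  1 + (n + 2)%:R *: 'X +
  \sum_(2 <= k < (n %/ 2).+1)
     ('C(n - k, k)%:R * (n%:R / (n - k)%:R)) *: 'X^k :> {poly rat}.
Proof.
move=> n4; rewrite sum_unlinked; last by lia.
rewrite sum_sparse_cycle; last by lia.
rewrite cycle_sum; last by lia.
pose c k : rat := 'C(n - k, k)%:R * (n%:R / (n - k)%:R).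
have -> : path_poly false false n.-1 + 'X * path_poly false false (n - 3) =
    \sum_(0 <= k < (n %/ 2).+1) c k *: 'X^k.
  apply/polyP => k; rewrite big_mkord coef_sum.
  under eq_bigr => i _ do rewrite coefZ coefXn.
  rewrite coefD coefXM !coef_path_poly prednK; last by lia.
  have [kn|kn] := ltnP k (n %/ 2).+1.
    rewrite (bigD1 (Ordinal kn)) //= eqxx mulr1 big1 ?addr0; last first.
      by move=> i; rewrite -val_eqE /= eq_sym => /negPf->; rewrite mulr0.
    rewrite /c -cycle_count //; last by lia.
    rewrite natrD; congr (_ + _); case: k kn => //= j _.
    by congr ('C(_, _)%:R); lia.
  rewrite big1; last first.
    by move=> i _; rewrite gtn_eqF ?mulr0//; exact: leq_trans (ltn_ord i) kn.
  rewrite bin_small ?add0r; last by lia.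
  case: k kn => //= j kn; rewrite bin_small //; lia.
have n2 : (2 <= (n %/ 2).+1)%N by lia.
(* The closed form is also valid for [k = 0] and [k = 1], but the term of degree
   one must be merged with the contribution [2 x] of the caps. *)
rewrite (big_ltn (m := 0)) // (big_ltn (m := 1)) //.
have c0 : c 0 = 1.
  by rewrite /c subn0 bin0 divff ?mulr1// pnatr_eq0; lia.
have c1 : c 1 = n%:R.
  rewrite /c bin1 mulrC divfK// pnatr_eq0; lia.
rewrite c0 c1 expr0 expr1 scale1r natrD scalerDl.
rewrite !scaler_nat -/c; set S := \sum_(2 <= k < _) _.
by rewrite -mulr_natr; ring.
Qed.

(** * Continuity, connectedness and spherical coordinates *)

Local Open Scope classical_set_scope.
Local Open Scope ring_scope.

Section Topology.
Variable R : realType.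

Lemma continuous_mx (T : topologicalType) m k (f : T -> 'M[R]_(m, k)) :
  (forall i j, continuous (fun x => f x i j)) -> continuous f.
Proof.
move=> h x; apply/cvg_mx_entourageP => A entA.
apply: filter_forall => i; apply: filter_forall => j.
have /cvg_entourageP/(_ A entA) := h i j x.
by apply: (@filterS _ (nbhs x) (nbhs_filter x)) => y ?; exact/mem_set.
Qed.

Lemma continuous_pair (T U V : topologicalType) (f : T -> U) (g : T -> V) :
  continuous f -> continuous g -> continuous (fun x => (f x, g x)).
Proof. by move=> cf cg x; exact: (cvg_pair (cf x) (cg x)). Qed.

Lemma closed_le_fun (T : topologicalType) (f g : T -> R) :
  continuous f -> continuous g -> closed [set x | f x <= g x].
Proof.
move=> cf cg.
have -> : [set x | f x <= g x] = (fun x => f x - g x) @^-1` [set y | y <= 0].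
  by apply/seteqP; split=> x /=; rewrite subr_le0.
apply: preimage_closed; last exact: closed_le.
by move=> x _; apply: cvgB; [exact: cf|exact: cg].
Qed.

(** Starting from any point of [A], the vertical segment to the height of [c]
    followed by the horizontal segment to [c] is connected and stays in [A]. *)
Lemma connected_hook (A : set (R * R)) (c : R * R) : A c ->
  (forall u (t : R), A u -> 0 <= t <= 1 -> A (u.1, u.2 + t * (c.2 - u.2))) ->
  (forall u (t : R), A u -> 0 <= t <= 1 -> A (u.1 + t * (c.1 - u.1), c.2)) ->
  connected A.
Proof.
move=> Ac vert horiz.
pose V (u : R * R) := (fun t : R => (u.1, u.2 + t * (c.2 - u.2))) @` `[0, 1].
pose H (u : R * R) := (fun t : R => (u.1 + t * (c.1 - u.1), c.2)) @` `[0, 1].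
have aff a b : continuous (fun t : R => a + t * b).
  move=> t; apply: cvgD; first exact: cvg_cst.
  by apply: cvgM; [exact: cvg_id|exact: cvg_cst].
have cV u : connected (V u).
  apply: connected_continuous_connected; first exact: segment_connected.
  apply: continuous_subspaceT; apply: continuous_pair; last exact: aff.
  by move=> t; exact: cvg_cst.
have cH u : connected (H u).
  apply: connected_continuous_connected; first exact: segment_connected.
  apply: continuous_subspaceT; apply: continuous_pair; first exact: aff.
  by move=> t; exact: cvg_cst.
have in0 : [set` `[(0:R), 1]] 0 by rewrite /= in_itv /= lexx ler01.
have in1 : [set` `[(0:R), 1]] 1 by rewrite /= in_itv /= lexx ler01.
have -> : A = \bigcup_(u in A) (V u `|` H u).
  apply/seteqP; split=> [u Au|_ [u Au [] [t t01 <-]]].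
  - exists u => //; left; exists 0 => //.
    by rewrite mul0r addr0; case: u {Au}.
  - by apply: vert => //; move: t01; rewrite /= in_itv.
  - by apply: horiz => //; move: t01; rewrite /= in_itv.
apply: bigcup_connected.
  exists c => u Au; right; exists 1 => //.
  by rewrite mul1r subrKC; case: (c).
move=> u Au; apply: connectedU => //.
exists (u.1, c.2); split.
  by exists 1 => //; rewrite mul1r subrKC.
by exists 0 => //; rewrite mul0r addr0.
Qed.

Lemma closure_curve (T : topologicalType) (U : set T) (c : R -> T) (b : R) :
  0 < b -> {for 0, continuous c} -> (forall t, 0 < t < b -> U (c t)) ->
  closure U (c 0).
Proof.
move=> b0 cc h B Bc.
have [t [tB t0 tb]] : exists t, [/\ B (c t), 0 < t & t < b].
  apply: (@filter_ex _ (0 : R)^'+); near=> t; split.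
  - by near: t; exact: (cvg_at_right_filter cc Bc).
  - by near: t; exact: nbhs_right_gt.
  - by near: t; exact: nbhs_right_lt.
by exists (c t); split => //; apply: h; rewrite t0.
Unshelve. all: by end_near. Qed.

Implicit Types (x y r : R).

Lemma polar X Y r : 0 <= r -> X ^+ 2 + Y ^+ 2 = r ^+ 2 ->
  exists2 x, 0 <= x <= 2 * pi & X = r * cos x /\ Y = r * sin x.
Proof.
move=> r0 e; have pi0 := @pi_gt0 R.
have [r00|rn0] := eqVneq r 0.
  exists 0; first by rewrite lexx mulr_ge0// ltW.
  move: e; rewrite r00 expr0n /= => /eqP.
  by rewrite paddr_eq0 ?sqr_ge0// !sqrf_eq0 !mul0r => /andP[/eqP-> /eqP->].
have rp : 0 < r by rewrite lt0r rn0.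
have c1 : -1 <= X / r <= 1.
  rewrite -ler_norml normf_div (gtr0_norm rp) ler_pdivrMr// mul1r.
  rewrite -ler_sqr ?nnegrE// -normrX ger0_norm ?sqr_ge0//.
  by rewrite -e lerDl sqr_ge0.
have cE : r * cos (acos (X / r)) = X by rewrite acosK ?in_itv// mulrC divfK.
have sE : r * sin (acos (X / r)) = `|Y|.
  rewrite sin_acos// -{1}(ger0_norm r0) -sqrtr_sqr -sqrtrM ?sqr_ge0//.
  rewrite mulrBr mulr1 -exprMn (mulrC r) divfK// -e addrAC subrr add0r.
  exact: sqrtr_sqr.
have a0 := acos_ge0 c1; have a1 := acos_lepi c1.
have [Y0|Y0] := leP 0 Y.
  exists (acos (X / r)); first by rewrite a0 /=; lra.
  by rewrite cE sE ger0_norm.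
exists (2 * pi - acos (X / r)); first by apply/andP; split; lra.
rewrite mulr_natl cosB sinB cos2pi sin2pi !mul0r !mul1r addr0 sub0r.
by rewrite mulrN cE sE ltr0_norm// opprK.
Qed.

Lemma sphericalP p : @sphere2 R p ->
  exists x y, [/\ 0 <= x <= 2 * pi, - (pi / 2) <= y <= pi / 2 &
                  p = spherical x y].
Proof.
rewrite /sphere2 /= !big_ord_recl big_ord0 addr0.
rewrite (_ : lift ord0 ord0 = 1); last exact: val_inj.
rewrite (_ : lift ord0 (lift ord0 ord0) = 2); last exact: val_inj.
move=> e.
have Z1 : p 0 2 ^+ 2 <= 1.
  by rewrite -e addrA lerDr addr_ge0// sqr_ge0.
have Z1' : -1 <= p 0 2 <= 1.
  by rewrite -ler_norml -ler_sqr ?nnegrE// -normrX ger0_norm ?sqr_ge0// expr1n.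
pose y := asin (p 0 2).
have [||x x2 [Xe Ye]] := @polar (p 0 0) (p 0 1) (cos y).
- by rewrite cos_asin// sqrtr_ge0.
- rewrite cos_asin// sqr_sqrtr ?subr_ge0// -e; ring.
exists x, y; split => //.
  by rewrite asin_geNpi2// asin_lepi2.
apply: row3P; rewrite ?spherical0 ?spherical1 ?spherical2//.
by rewrite asinK// in_itv.
Qed.

(** At the poles the longitude is not determined by the point. *)
Lemma spherical_eq x y x' y' :
  - (pi / 2) <= y <= pi / 2 -> - (pi / 2) <= y' <= pi / 2 ->
  spherical x y = spherical x' y' ->
  y = y' /\ (`|y| = pi / 2 \/ (cos x = cos x' /\ sin x = sin x')).
Proof.
move=> hy hy' e.
have yy : y = y'.
  apply: sin_inj; rewrite ?in_itv //=.
  by have := congr1 (fun M : 'rV[R]_3 => M 0 2) e; rewrite !spherical2.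
subst y'; split => //.
have [|npole] := eqVneq `|y| (pi / 2); first by left.
have cy : cos y != 0.
  rewrite lt0r_neq0// cos_gt0_pihalf//.
  by rewrite -ltr_norml lt_neqAle npole ler_norml.
right; split; apply: (mulfI cy).
- by have := congr1 (fun M : 'rV[R]_3 => M 0 0) e; rewrite !spherical0.
- by have := congr1 (fun M : 'rV[R]_3 => M 0 1) e; rewrite !spherical1.
Qed.

Lemma angle_eq x x' : 0 <= x <= 2 * pi -> 0 <= x' <= 2 * pi ->
  cos x = cos x' -> sin x = sin x' ->
  [\/ x = x', x = 0 /\ x' = 2 * pi | x = 2 * pi /\ x' = 0].
Proof.
wlog xx' : x x' / x <= x'.
  move=> wl hx hx' c s; have [xx'|/ltW xx'] := leP x x'; first exact: wl.
  by case: (wl _ _ xx' hx' hx (esym c) (esym s)) => [->|[-> ->]|[-> ->]];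
    [constructor 1|constructor 3|constructor 2].
move=> hx hx' c s.
have cd : cos (x' - x) = 1 by rewrite cosB c s -!expr2 cos2Dsin2.
have [lt|ge] := ltP (x' - x) (2 * pi).
  constructor 1; have /eqP : x' - x = 0.
    by apply: cos_eq1 cd; rewrite -mulr_natl subr_ge0 xx'.
  by rewrite subr_eq0 => /eqP.
by constructor 2; split; lra.
Qed.

Lemma multiple_angle x n : cos x = 1 -> sin x = 0 ->
  cos (n%:R * x) = 1 /\ sin (n%:R * x) = 0.
Proof.
move=> c s; elim: n => [|n [IHc IHs]]; first by rewrite mul0r cos0 sin0.
rewrite -natr1 mulrDl mul1r cosD sinD IHc IHs c s.
by rewrite !mulr1 !mul0r mulr0 subr0 addr0.
Qed.

(** The absolute value of the sine of half an angle is a function of the cosine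
    of the angle, and [cos (n x)] is a function of [cos x] and [sin x]. Thus the
    two strands together are well defined on the sphere, although [n x / 2] is
    only defined modulo [n pi]. *)
Lemma half_multiple_angle x x' n : cos x = cos x' -> sin x = sin x' ->
  `|sin (n%:R / 2 * x)| = `|sin (n%:R / 2 * x')|.
Proof.
move=> c s.
have cd : cos (x - x') = 1 by rewrite cosB c s -!expr2 cos2Dsin2.
have sd : sin (x - x') = 0 by rewrite sinB c s mulrC subrr.
have [cn sn] := multiple_angle n cd sd.
have e z : sin (n%:R / 2 * z) ^+ 2 = (1 - cos (n%:R * z)) / 2.
  have -> : n%:R * z = (n%:R / 2 * z) *+ 2 by rewrite -mulr_natl; field.
  by rewrite cos_mulr2n sin2cos2 -mulr_natl; field.
rewrite -!sqrtr_sqr !e.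
have -> : n%:R * x = n%:R * x' + n%:R * (x - x') by ring.
by rewrite cosD cn sn mulr1 mulr0 subr0.
Qed.

(** The latitude of the upper one of the two strands, at the longitude that is
    [s] times the angle between consecutive crossings. *)
Definition height (s : R) : R := `|sin (pi * s)|.

Lemma height_ge0 s : 0 <= height s. Proof. exact: normr_ge0. Qed.

Lemma height_lt_pihalf s : height s < pi / 2.
Proof. exact: le_lt_trans (sin_max _) one_lt_pihalf. Qed.

Lemma heightD s k : height (s + k%:R) = height s.
Proof.
rewrite /height mulrDr mulr_natr (alternatingn (@sinDpi R)).
by rewrite normrM normrX normrN1 expr1n mul1r.
Qed.

Lemma height_nat k : height k%:R = 0.
Proof. by rewrite -[k%:R]add0r heightD /height mulr0 sin0 normr0. Qed.

Lemma height_gt0 s : 0 < s < 1 -> 0 < height s.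
Proof.
move=> /andP[s0 s1]; rewrite normr_gt0 lt0r_neq0// sin_gt0_pi//.
by rewrite mulr_gt0 ?pi_gt0//= gtr_pMr ?pi_gt0.
Qed.

Lemma height_half : height (2^-1) = 1.
Proof. by rewrite /height sin_pihalf normr1. Qed.

Lemma height_neq0 s k : k%:R < s < k.+1%:R -> 0 < height s.
Proof.
move=> h; rewrite -[s](subrK k%:R) heightD height_gt0//.
by rewrite subr_gt0 ltrBlDl natr1; move: h.
Qed.

Lemma height_eq0 s : 0 <= s -> height s = 0 -> exists k : nat, s = k%:R.
Proof.
move=> s0 h; exists (Num.truncn s).
have /andP[le lt] := truncn_itv s0.
apply/eqP; rewrite eq_le le andbT leNgt; apply/negP => lt'.
by have := @height_neq0 s (Num.truncn s); rewrite lt' lt h ltxx => /(_ isT).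
Qed.

Lemma continuous_height : continuous height.
Proof.
move=> s; apply: cvg_norm; apply: continuous_comp; last exact: continuous_sin.
by apply: cvgM; [exact: cvg_cst|exact: cvg_id].
Qed.

End Topology.

(** * The faces of the torus projection *)

Section Regions.
Variables (R : realType) (n : nat) (n_gt0 : (0 < n)%N).
Implicit Types (u v : R * R) (f g : 'I_n + bool).

Let n0 : 0 < n%:R :> R. Proof. by rewrite ltr0n. Qed.
Let nn0 : n%:R != 0 :> R. Proof. exact: lt0r_neq0. Qed.

Definition chart u : 'rV[R]_3 := spherical (2 * pi * u.1 / n%:R) u.2.

Definition chart_dom : set (R * R) := `[0, n%:R] `*` `[- (pi / 2), pi / 2].

Lemma chart_domE u :
  chart_dom u <-> (0 <= u.1 <= n%:R) /\ (- (pi / 2) <= u.2 <= pi / 2).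
Proof. by rewrite /chart_dom /setX /= !in_itv. Qed.

Lemma continuous_chart : continuous chart.
Proof.
have c1 : continuous (fun u => 2 * pi * u.1 / n%:R).
  move=> u; apply: cvgM; last exact: cvg_cst.
  by apply: cvgM; [exact: cvg_cst|exact: cvg_fst].
have c2 : continuous (fun u : R * R => u.2) by move=> u; exact: cvg_snd.
have comp (h : R -> R) (k : R * R -> R) :
    continuous h -> continuous k -> continuous (fun u => h (k u)).
  by move=> ch ck u; apply: continuous_comp; [exact: ck|exact: ch].
apply: continuous_mx => i j; rewrite (ord1 i) => u.
case: j => -[|[|[|//]]] lt_j; rewrite /chart /spherical.
- under [X in continuous_at _ X]eq_fun do rewrite mxE /=.
  by apply: cvgM; apply: comp => //; exact: continuous_cos.
- under [X in continuous_at _ X]eq_fun do rewrite mxE /=.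
  apply: cvgM; apply: comp => //; [exact: continuous_cos|exact: continuous_sin].
- under [X in continuous_at _ X]eq_fun do rewrite mxE /=.
  by apply: comp => //; exact: continuous_sin.
Qed.

Lemma chart_surj p : @sphere2 R p -> exists2 u, chart_dom u & p = chart u.
Proof.
have pi0 := @pi_gt0 R.
move=> /sphericalP[x [y [/andP[x0 x1] hy ->]]].
exists (x * n%:R / (2 * pi), y).
  apply/chart_domE; split=> //=.
  apply/andP; split; first by rewrite divr_ge0 ?mulr_ge0// ltW.
  by rewrite ler_pdivrMr ?mulr_gt0// mulrC ler_pM2l.
rewrite /chart /=; congr spherical.
(* Generalizing [pi] keeps [field] from unfolding it. *)
by move: pi0; move: (@pi R) => q q0; field; rewrite nn0 gt_eqF.
Qed.

(** The chart is injective, except that it collapses each of the horizontal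
    sides of the rectangle to a pole and glues its vertical sides together. *)
Lemma chart_eq u v : chart_dom u -> chart_dom v -> chart u = chart v ->
  u.2 = v.2 /\ [\/ `|u.2| = pi / 2, u.1 = v.1,
                   u.1 = 0 /\ v.1 = n%:R | u.1 = n%:R /\ v.1 = 0].
Proof.
have pi0 := @pi_gt0 R.
move=> /chart_domE[u1 u2] /chart_domE[v1 v2] /(spherical_eq u2 v2)[e h].
split=> //; case: h => [|[c s]]; first by constructor 1.
have ang (s' : R) : 0 <= s' <= n%:R -> 0 <= 2 * pi * s' / n%:R <= 2 * pi.
  move=> /andP[s0 sn]; apply/andP; split.
    by rewrite divr_ge0 ?ler0n// !mulr_ge0// ltW.
  by rewrite ler_pdivrMr// ler_pM2l// mulr_gt0.
have back (s' : R) : s' = (2 * pi * s' / n%:R) * (n%:R / (2 * pi)).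
  by move: pi0; move: (@pi R) => q q0; field; rewrite nn0 gt_eqF.
have full : n%:R = 2 * pi * (n%:R / (2 * pi)) :> R.
  by move: pi0; move: (@pi R) => q q0; field; rewrite gt_eqF.
case: (angle_eq (ang _ u1) (ang _ v1) c s) => [e'|[e' e'']|[e' e'']].
- by constructor 2; rewrite (back u.1) e' -back.
- by constructor 3; rewrite (back u.1) (back v.1) e' e'' mul0r -full.
- by constructor 4; rewrite (back u.1) (back v.1) e' e'' mul0r -full.
Qed.

(** The image is compact, as the rectangle is. *)
Lemma chart_closed (K : set (R * R)) :
  closed K -> closed (chart @` (chart_dom `&` K)).
Proof.
move=> cK; apply: compact_closed; first exact: norm_hausdorff.
apply: continuous_compact.
  by apply: continuous_subspaceT; exact: continuous_chart.
apply: compact_closedI => //.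
by apply: compact_setX; exact: segment_compact.
Qed.

Definition face f : set (R * R) :=
  match f with
  | inl k => [set u | `|u.2| < height u.1 /\ k%:R < u.1 < k.+1%:R]
  | inr b => [set u | height u.1 < (-1) ^+ b * u.2]
  end.

(** The closure of the face in the plane, which meets the complement of the two
    strands in the face itself. *)
Definition closed_face f : set (R * R) :=
  match f with
  | inl k => [set u | `|u.2| <= height u.1 /\ k%:R <= u.1 <= k.+1%:R]
  | inr b => [set u | height u.1 <= (-1) ^+ b * u.2]
  end.

(* These facts discharge the hypotheses of [closed_le_fun] below. *)
Let continuous_abscissa : continuous (fun u : R * R => u.1).
Proof. by move=> u; exact: cvg_fst. Qed.

Let continuous_ordinate : continuous (fun u : R * R => u.2).
Proof. by move=> u; exact: cvg_snd. Qed.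

Let continuous_height_abscissa : continuous (fun u : R * R => height u.1).
Proof.
move=> u.
exact: (continuous_comp (@continuous_abscissa u) (@continuous_height R u.1)).
Qed.

Let continuous_norm_ordinate : continuous (fun u : R * R => `|u.2|).
Proof. by move=> u; apply: cvg_norm; exact: continuous_ordinate. Qed.

Let continuous_signed_ordinate (b : bool) :
  continuous (fun u : R * R => (-1) ^+ b * u.2).
Proof.
by move=> u; apply: cvgM; [exact: cvg_cst|exact: continuous_ordinate].
Qed.

Let continuous_constant (r : R) : continuous (fun _ : R * R => r).
Proof. by move=> u; exact: cvg_cst. Qed.

Lemma closed_closed_face f : closed (closed_face f).
Proof.
case: f => [k|b] /=; last exact: closed_le_fun.
have -> : [set u | `|u.2| <= height u.1 /\ k%:R <= u.1 <= k.+1%:R] =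
  [set u : R * R | `|u.2| <= height u.1] `&`
    ([set u | k%:R <= u.1] `&` [set u | u.1 <= k.+1%:R]).
  by apply/seteqP; split=> u /= [? /andP].
by apply: closedI; [|apply: closedI]; exact: closed_le_fun.
Qed.

Lemma closed_setC_face f : closed (~` face f).
Proof.
case: f => [k|b] /=; last first.
  have -> : ~` [set u | height u.1 < (-1) ^+ b * u.2] =
      [set u : R * R | (-1) ^+ b * u.2 <= height u.1].
    by apply/seteqP; split=> u /=; rewrite leNgt => /negP.
  exact: closed_le_fun.
have -> : ~` [set u | `|u.2| < height u.1 /\ k%:R < u.1 < k.+1%:R] =
  [set u : R * R | height u.1 <= `|u.2|] `|`
    ([set u | u.1 <= k%:R] `|` [set u | k.+1%:R <= u.1]).
  apply/seteqP; split=> u /=.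
    move/not_andP; rewrite !leNgt => -[/negP|/negP]; first by left.
    by rewrite negb_and => /orP[]; right; [left|right].
  rewrite !leNgt; case=> [/negP h []//|[/negP h|/negP h]];
    by move=> [_ /andP[]].
by apply: closedU; [|apply: closedU]; exact: closed_le_fun.
Qed.

Lemma faceP f u : face f u <-> closed_face f u /\ `|u.2| <> height u.1.
Proof.
case: f => [k|b] /=; last first.
  split=> [h|[h ne]]; last first.
    rewrite lt_neqAle h andbT; apply/eqP => e; apply: ne.
    by rewrite e -[RHS]ger0_norm -?e ?height_ge0// e normrMsign.
  split; first exact: ltW.
  move=> e; have := ler_norm ((-1) ^+ b * u.2).
  by rewrite normrMsign e leNgt h.
split=> [[h /andP[a b]]|[[h /andP[a b]] /eqP ne]].
  by rewrite !ltW//; split=> // e; rewrite e ltxx in h.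
have lt : `|u.2| < height u.1 by rewrite lt_neqAle ne.
have pos : height u.1 != 0 by rewrite gt_eqF// (le_lt_trans _ lt).
split=> //; rewrite !lt_neqAle a b !andbT; apply/andP; split.
  by apply: contraNneq pos => <-; rewrite height_nat.
by apply: contraNneq pos => ->; rewrite height_nat.
Qed.

Lemma face_cover u : chart_dom u -> `|u.2| = height u.1 \/ exists f, face f u.
Proof.
move=> /chart_domE[/andP[u0 un] _].
have [lt|gt|->] := ltgtP `|u.2| (height u.1); last by left.
- right; have k_n : (Num.truncn u.1 < n)%N.
    rewrite -(ltr_nat R); apply: (@le_lt_trans _ _ u.1).
      by have /andP[] := truncn_itv u0.
    rewrite lt_neqAle un andbT; apply/eqP => e.
    by move: lt; rewrite e height_nat ltNge normr_ge0.
  exists (inl (Ordinal k_n)); apply/faceP; split.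
    by have /andP[h1 h2] := truncn_itv u0; rewrite /= h1 !ltW.
  by move=> e; rewrite e ltxx in lt.
- right; exists (inr (u.2 < 0)); rewrite /= (lt_le_trans gt)//.
  by case: ltP => [/ltr0_norm->|/ger0_norm->]; rewrite ?mulN1r ?mul1r.
Qed.

Lemma face_disjoint f g u : face f u -> face g u -> f = g.
Proof.
have nat_itv (i j : nat) : i%:R < u.1 -> u.1 < j%:R -> (i < j)%N.
  by move=> h1 h2; rewrite -(ltr_nat R); apply: lt_trans h2.
have mix (k : 'I_n) b : face (inl k) u -> ~ face (inr b) u.
  move=> [h _] /= h'; have := ler_norm ((-1) ^+ b * u.2).
  rewrite normrMsign leNgt.
  by rewrite (lt_trans h).
case: f g => [i|b] [j|c] fu gu.
- have [_ /andP[a1 a2]] := fu; have [_ /andP[b1 b2]] := gu.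
  congr inl; apply/val_inj/eqP; rewrite eqn_leq.
  by rewrite -[(i <= j)%N]ltnS -[(j <= i)%N]ltnS !nat_itv.
- by case: (mix i c).
- by case: (mix j b).
- have h0 := height_ge0 u.1; move: fu gu.
  case: b; case: c => //=; rewrite expr0 expr1 mul1r mulN1r => h1 h2;
    by exfalso; lra.
Qed.

(** Points identified by the chart lie in the same face: the poles are well
    inside the caps, since [height s < pi / 2], and no bigon reaches the
    vertical sides, where the height vanishes. *)
Lemma face_chart_eq f u v : chart_dom u -> chart_dom v -> chart u = chart v ->
  face f u -> face f v.
Proof.
move=> Du Dv /(chart_eq Du Dv)[e2 [pole|e1|[u1 v1]|[u1 v1]]].
- have hu := height_lt_pihalf u.1; have hv := height_lt_pihalf v.1.
  case: f => [k|b] /=; rewrite -e2 ?pole => h; first by case: h; lra.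
  have -> : (-1) ^+ b * u.2 = pi / 2.
    rewrite -pole -(normrMsign b) ger0_norm//.
    by rewrite (le_trans (height_ge0 u.1))// ltW.
  exact: height_lt_pihalf.
- by case: u v e2 e1 {Du Dv} => [u1 u2] [v1 v2] /= -> ->.
- case: f => [k|b] /=; rewrite u1 v1 -e2 height_nat -[0]/(0%:R) height_nat //.
  by rewrite normr_lt0 => -[].
- case: f => [k|b] /=; rewrite u1 v1 -e2 height_nat -[0]/(0%:R) height_nat //.
  by rewrite normr_lt0 => -[].
Qed.

Lemma chart_on_sphere u : sphere2 (chart u).
Proof. exact: spherical_on_sphere. Qed.

Let L := @torus_projection R n n_gt0.

(** The curves are parametrized by longitudes beyond one turn. Every point of
    theirs has a representative in the rectangle, and [half_multiple_angle] says
    that it is on one of the strands there. For the converse, the sign of [y]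
    selects the component of the link if [n] is even, and the first or the
    second turn of the only component if [n] is odd. *)
Lemma torus_projectionP p :
  projection_image L p <->
  exists u, [/\ chart_dom u, `|u.2| = height u.1 & p = chart u].
Proof.
have pi0 := @pi_gt0 R.
split=> [[i [t <-]]|[[s y] [/chart_domE/=[/andP[s0 sn] _] ye ->]]].
- have [u Du e] := chart_surj
    (spherical_on_sphere (torus_longitude n t) (torus_latitude i t)).
  exists u; split=> //; have /chart_domE[_ u2] := Du.
  have lat1 : `|torus_latitude i t| <= 1 by rewrite normrMsign sin_max.
  have pih := @one_lt_pihalf R.
  have [|yE [pole|[c s]]] := spherical_eq _ u2 e.
  + by rewrite -ler_norml (le_trans lat1)// ltW.
  + by move: lat1; rewrite pole leNgt pih.
  rewrite -yE normrMsign (half_multiple_angle n c s) /height.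
  by congr `|sin _|; field.
- have [sg ys] : exists b : bool, y = (-1) ^+ b * sin (pi * s).
    move: ye; rewrite /height => /eqP; rewrite eqr_norm2 => /orP[]/eqP->.
      by exists false; rewrite mul1r.
    by exists true; rewrite mulN1r.
  have [[dE on]|[dE en]] := gcd2_case n; last first.
    have lt_sg : (sg < gcdn 2 n)%N by rewrite dE; case: (sg).
    exists (Ordinal lt_sg), (s / n%:R).
    rewrite /= /torus_curve /torus_latitude /torus_longitude /chart /= dE ys.
    by congr spherical; [field|congr (_ * sin _); field].
  have lt0 : (0 < gcdn 2 n)%N by rewrite dE.
  exists (Ordinal lt0), (s / (2 * n%:R) + sg%:R / 2).
  rewrite /= /torus_curve /torus_latitude /torus_longitude /chart /= dE ys.
  rewrite expr0 mul1r.
  have -> : 4 * pi / 1 * (s / (2 * n%:R) + sg%:R / 2) =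
      2 * pi * s / n%:R + pi *+ (2 * sg).
    by rewrite -[pi *+ _]mulr_natr natrM; field.
  have -> : n%:R / 2 * (2 * pi * s / n%:R + pi *+ (2 * sg)) =
      pi * s + pi *+ (n * sg).
    by rewrite -![pi *+ _]mulr_natr !natrM; field.
  rewrite (alternatingn (@sinDpi R)) exprM -(signr_odd _ n) on expr1.
  rewrite /spherical mulrnA.
  by rewrite (periodicn (@cosD2pi R)) (periodicn (@sinD2pi R)).
Qed.

Definition region f : set 'rV[R]_3 := chart @` (chart_dom `&` face f).

Lemma regionE f u : chart_dom u -> region f (chart u) <-> face f u.
Proof.
move=> Du; split=> [[v [Dv fv]] e|fu]; last by exists u.
exact: face_chart_eq Dv Du e fv.
Qed.

Let complement := @sphere2 R `\` projection_image L.

Lemma region_sub f : region f `<=` complement.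
Proof.
move=> _ [u [Du fu] <-]; split; first exact: chart_on_sphere.
move=> /torus_projectionP[v [Dv vP e]].
by have /faceP[_] := face_chart_eq Du Dv e fu; apply.
Qed.

Lemma region_cover p : complement p -> exists f, region f p.
Proof.
move=> [/chart_surj[u Du ->] nP]; have [e|[f fu]] := face_cover Du.
  by case: nP; apply/torus_projectionP; exists u.
by exists f; apply/regionE.
Qed.

Definition center f : R * R :=
  match f with
  | inl k => (k%:R + 2^-1, 0)
  | inr b => (0, (-1) ^+ b * (pi / 2))
  end.

Lemma center_dom f : chart_dom (center f).
Proof.
have pi0 := @pi_gt0 R; apply/chart_domE; case: f => [k|b] /=.
  have k0 : 0 <= k%:R :> R by [].
  have kn : k%:R + 1 <= n%:R :> R by rewrite natr1 ler_nat.
  by split; apply/andP; split; lra.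
split; first by rewrite lexx ltW.
by case: b; rewrite ?expr0 ?expr1 ?mul1r ?mulN1r; apply/andP; split; lra.
Qed.

Lemma center_face f : face f (center f).
Proof.
case: f => [k|b] /=.
  rewrite normr0 addrC heightD height_half; split=> //.
  by rewrite -(natr1 k); apply/andP; split; lra.
by rewrite mulrA -expr2 sqrr_sign mul1r; exact: height_lt_pihalf.
Qed.

Lemma region_connected f : connected (region f).
Proof.
apply: connected_continuous_connected; last first.
  by apply: continuous_subspaceT; exact: continuous_chart.
have conv (a b x y t : R) : a <= x <= b -> a <= y <= b -> 0 <= t <= 1 ->
    a <= x + t * (y - x) <= b.
  move=> /andP[ax xb] /andP[ay yb] /andP[t0 t1].
  have t1' : 0 <= 1 - t by lra.
  have : 0 <= (1 - t) * (x - a) + t * (y - a).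
    by rewrite addr_ge0// mulr_ge0//; lra.
  have : 0 <= (1 - t) * (b - x) + t * (b - y).
    by rewrite addr_ge0// mulr_ge0//; lra.
  by move=> h1 h2; apply/andP; split; lra.
have lconv (a x y t : R) : a < x -> a < y -> 0 <= t <= 1 -> a < x + t * (y - x).
  move=> ax ay t01.
  have /andP[h _] : Num.min x y <= x + t * (y - x) <= Num.max x y.
    by apply: conv => //; rewrite ge_min le_max lexx ?orbT.
  by apply: lt_le_trans h; rewrite lt_min ax.
have sconv (a b x y t : R) : a < x < b -> a < y < b -> 0 <= t <= 1 ->
    a < x + t * (y - x) < b.
  move=> /andP[ax xb] /andP[ay yb] t01; rewrite lconv//=.
  have : - b < - x + t * (- y - - x) by apply: lconv; rewrite ?ltrN2.
  by lra.
have Dc := center_dom f; have fc := center_face f.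
have /chart_domE[d1 d2] := Dc.
apply: (@connected_hook _ _ (center f)) => // u t [/chart_domE[u1 u2] fu] t01.
- split; first by apply/chart_domE; split => //=; apply: conv.
  case: f fu {Dc fc d1 d2} => [k|b] /=.
    move=> [h hk]; split=> //; apply: le_lt_trans h.
    have -> : u.2 + t * (0 - u.2) = (1 - t) * u.2 by ring.
    by rewrite normrM ger0_norm; [apply: ler_piMl => //; lra|lra].
  move=> h; have := height_lt_pihalf u.1.
  have -> : (-1) ^+ b * (u.2 + t * ((-1) ^+ b * (pi / 2) - u.2)) =
      (-1) ^+ b * u.2 +
      t * (((-1) ^+ b * (-1) ^+ b) * (pi / 2) - (-1) ^+ b * u.2) by ring.
  by rewrite -expr2 sqrr_sign mul1r => hp; exact: lconv.
- split; first by apply/chart_domE; split => //=; apply: conv.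
  case: f fu fc {Dc d1 d2} => [k|b] /=.
    move=> [h hk] [_ hk']; split; last exact: sconv.
    rewrite normr0; apply: (@height_neq0 _ _ k); exact: sconv.
  by move=> _ _; rewrite mulrA -expr2 sqrr_sign mul1r; exact: height_lt_pihalf.
Qed.

(** A connected [C] in the complement of the projection that meets the region
    is contained in it, since [C `&` region f] is both open and closed in [C].
    It is open because the points outside of the face have a closed image, and
    closed because the closed face adds to the region only points of the
    projection. *)
Lemma region_component f p :
  region f p -> connected_component complement p = region f.
Proof.
move=> fp; apply/seteqP; split; last first.
  exact: connected_component_max fp (@region_sub f) (@region_connected f).
move=> q [C [Cp CS Cc] Cq].
suff CE : C `&` region f = C by move: Cq; rewrite -CE => -[].
apply: Cc.
- by exists p.
- exists (~` (chart @` (chart_dom `&` ~` face f))).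
    by apply: closed_openC; apply: chart_closed; exact: closed_setC_face.
  apply/seteqP; split=> [r [Cr fr]|r [Cr nr]]; split=> //.
    move=> [u [Du nu] e]; apply: nu; apply/(regionE f Du).
    by rewrite e.
  have [/chart_surj[u Du e] _] := CS _ Cr; rewrite e in nr *.
  apply/(regionE f Du); apply: contrapT => nu; apply: nr; by exists u.
- exists (chart @` (chart_dom `&` closed_face f)).
    by apply: chart_closed; exact: closed_closed_face.
  apply/seteqP; split=> [r [Cr [u [Du fu] e]]|r [Cr [u [Du fu] e]]]; split=> //.
    by exists u => //; split=> //; case/faceP: fu.
  rewrite -e; apply/(regionE f Du)/faceP; split=> // h.
  have [_ nP] := CS _ Cr; apply: nP; apply/torus_projectionP; by exists u.
Qed.

Lemma region_center f : region f (chart (center f)).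
Proof.
by exists (center f) => //; split; [exact: center_dom|exact: center_face].
Qed.

Lemma region_inj : injective region.
Proof.
move=> f g e; have := region_center f.
by rewrite e => /(regionE g (center_dom f))/(face_disjoint (center_face f)).
Qed.

Lemma regions_range : regions L = range region.
Proof.
apply/seteqP; split=> [U [p cp <-]|U [f _ <-]].
  have [f fp] := region_cover cp; exists f => //.
  by rewrite (region_component fp).
have fp := region_center f.
exists (chart (center f)); [exact: region_sub fp|exact: region_component].
Qed.

(** * Crossings and boundaries of regions *)

Lemma chart_wrap (y : R) : chart (n%:R, y) = chart (0, y).
Proof.
rewrite /chart /= mulr0 mul0r -mulrA divff// mulr1 mulr_natl.
by rewrite /spherical cos2pi sin2pi cos0 sin0.
Qed.

Lemma nat_chart_dom (k : nat) : (k <= n)%N -> chart_dom (k%:R : R, 0).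
Proof.
move=> kn; apply/chart_domE => /=; rewrite ler0n ler_nat kn.
have := @pi_gt0 R; split=> //; apply/andP; split; lra.
Qed.

Lemma chart_ordS (j : 'I_n) : chart ((ordS j)%:R : R, 0) = chart (j.+1%:R, 0).
Proof.
rewrite /=; have := ltn_ord j; rewrite leq_eqVlt => /orP[/eqP->|lt].
  by rewrite modnn chart_wrap.
by rewrite modn_small.
Qed.

(** At a double point the latitude is zero ([torus_double_point]), that is,
    [height s = 0]. *)
Lemma crossingsP p : crossings L p <-> exists k : 'I_n, p = chart (k%:R, 0).
Proof.
split=> [[u [v [hu hv uv]]]|[k ->]].
- have [Su _ _ _ _] := torus_double_point n_gt0 hu hv uv.
  have [_ e] := hu.
  have /torus_projectionP[[s y] [Dw hw ep]] : projection_image L p.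
    by exists u.1, u.2.
  have lat0 : torus_latitude u.1 u.2 = 0.
    move: Su; rewrite /= /torus_latitude /torus_longitude.
    by rewrite -(mulrA (n%:R / 2)).
  have /chart_domE[/andP[s0 sn] w2] := Dw.
  have pih := @pi_gt0 R.
  have es : spherical (torus_longitude n u.2) 0 = chart (s, y).
    by rewrite -ep -e -[RHS]/(torus_curve u.1 u.2) /torus_curve lat0.
  have [|y0 _] := spherical_eq _ w2 es; first by apply/andP; split; lra.
  move: y0 hw s0 sn Dw ep => /= <-; rewrite normr0 => /esym h0 s0 sn _ ep.
  have [k sk] := height_eq0 s0 h0; rewrite sk in ep sn.
  move: sn; rewrite ler_nat leq_eqVlt => /orP[/eqP kn|kn].
    by exists (Ordinal n_gt0); rewrite ep kn chart_wrap.
  by exists (Ordinal kn).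
- have k1 : k%:R < n%:R :> R by rewrite ltr_nat.
  have k0 : 0 <= k%:R :> R by [].
  have sk : sin (pi * k%:R) = 0 :> R.
    by apply/eqP; rewrite -normr_eq0 -/(height _) height_nat.
  have kn0 : 0 <= k%:R / n%:R :> R by rewrite divr_ge0.
  have kn1 : k%:R / n%:R < 1 :> R by rewrite ltr_pdivrMr// mul1r.
  have [[dE on]|[dE en]] := gcd2_case n.
    have lt0 : (0 < gcdn 2 n)%N by rewrite dE.
    (* The two turns of the only component differ by half a period. *)
    have tE (b : bool) :
        torus_curve (Ordinal lt0) (k%:R / n%:R / 2 + b%:R / 2) =
        chart (k%:R : R, 0).
      rewrite /torus_curve /torus_latitude /torus_longitude /chart /= dE.
      rewrite expr0 mul1r.
      have -> : 4 * pi / 1 * (k%:R / n%:R / 2 + b%:R / 2) =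
          2 * pi * k%:R / n%:R + pi *+ (2 * b) :> R.
        by rewrite -[pi *+ _]mulr_natr natrM; field.
      have -> : n%:R / 2 * (2 * pi * k%:R / n%:R + pi *+ (2 * b)) =
          pi * k%:R + pi *+ (n * b) :> R.
        by rewrite -![pi *+ _]mulr_natr !natrM; field.
      rewrite (alternatingn (@sinDpi R)) sk mulr0.
      rewrite /spherical mulrnA.
      by rewrite (periodicn (@cosD2pi R)) (periodicn (@sinD2pi R)).
    exists (Ordinal lt0, k%:R / n%:R / 2 + false%:R / 2),
           (Ordinal lt0, k%:R / n%:R / 2 + true%:R / 2).
    split; [split; last exact: tE|split; last exact: tE|] => /=.
    + by apply/andP; split; lra.
    + by apply/andP; split; lra.
    + by move=> -[]; lra.
  have lt0 : (0 < gcdn 2 n)%N by rewrite dE.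
  have lt1 : (1 < gcdn 2 n)%N by rewrite dE.
  have tE (i : 'I_(gcdn 2 n)) :
      torus_curve i (k%:R / n%:R) = chart (k%:R : R, 0).
    rewrite /torus_curve /torus_latitude /torus_longitude /chart /=.
    move: ((-1) ^+ i) => sg; rewrite dE.
    have -> : 4 * pi / 2 * (k%:R / n%:R) = 2 * pi * k%:R / n%:R :> R by field.
    have -> : n%:R / 2 * (2 * pi * k%:R / n%:R) = pi * k%:R :> R by field.
    by rewrite sk mulr0.
  exists (Ordinal lt0, k%:R / n%:R), (Ordinal lt1, k%:R / n%:R).
  have r01 : 0 <= (k%:R / n%:R : R) < 1 by rewrite kn0 kn1.
  by split; [split=> //; exact: tE|split=> //; exact: tE|case].
Qed.

Lemma continuous_chart_line (a b c d : R) :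
  continuous (fun t : R => chart (a + t * b, c + t * d)).
Proof.
have aff (x y : R) : continuous (fun t : R => x + t * y).
  move=> t; apply: cvgD; first exact: cvg_cst.
  by apply: cvgM; [exact: cvg_id|exact: cvg_cst].
move=> t; apply: (continuous_comp (f := fun t : R => (a + t * b, c + t * d))).
  by apply: continuous_pair; exact: aff.
exact: continuous_chart.
Qed.

(** A crossing lies on the projection, so it is on the boundary of a region as
    soon as it is in its closure. It is in the closure of a cap by approaching
    it along its meridian, and of the bigons next to it by approaching it along the
    equator. It is not in the closure of other bigons, which is contained in
    the closed image of the closed face. *)
Lemma boundary_region f (k : 'I_n) :
  boundary (region f) (chart (k%:R, 0)) <->
  if f is inl j then k = j \/ k = ordS j else True.
Proof.
have pi0 := @pi_gt0 R.
have cl : boundary (region f) (chart (k%:R, 0)) <->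
    closure (region f) (chart (k%:R, 0)).
  split=> [[]//|h]; split=> //; apply: subset_closure; split.
    exact: chart_on_sphere.
  move=> /region_sub[_]; apply; apply/torus_projectionP.
  exists (k%:R, 0); split=> //; first exact: nat_chart_dom (ltnW _).
  by rewrite /= normr0 height_nat.
rewrite {}cl; case: f => [j|b]; last first.
  split=> // _.
  have := @closure_curve R _ (region (inr b))
    (fun t => chart (k%:R + t * 0, 0 + t * (-1) ^+ b)) (pi / 2).
  rewrite !mul0r !addr0; apply; first by rewrite divr_gt0.
    exact: continuous_chart_line.
  move=> t /andP[t0 t1]; rewrite mulr0 addr0 add0r.
  exists (k%:R, t * (-1) ^+ b) => //.
  split.
    have [] := (chart_domE _).1 (nat_chart_dom (ltnW (ltn_ord k))).
    move=> h _; apply/chart_domE; split=> //=.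
    by rewrite -ler_norml mulrC normrMsign ger0_norm ltW.
  by rewrite /= height_nat mulrCA -expr2 sqrr_sign mulr1.
have mid (t : R) : 0 < t < 1 -> region (inl j) (chart (j%:R + t, 0)).
  move=> /andP[t0 t1]; exists (j%:R + t, 0) => //; split.
    have j0 : 0 <= j%:R :> R by [].
    have jn : j%:R + 1 <= n%:R :> R by rewrite natr1 ler_nat.
    by apply/chart_domE; split=> /=; apply/andP; split; lra.
  rewrite /= normr0 addrC heightD height_gt0 ?t0//; split=> //.
  by rewrite -(natr1 j); apply/andP; split; lra.
split=> [h|[->|->]].
- have /chart_closed/(closure_id _).1 cE := @closed_closed_face (inl j).
  have : closure (chart @` (chart_dom `&` closed_face (inl j)))
      (chart (k%:R, 0)).
    apply: closureS h => _ [u [Du /faceP[fu _]] <-]; by exists u.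
  rewrite -cE => -[u [Du [_ /andP[ju uj]]] e].
  have Dk := nat_chart_dom (ltnW (ltn_ord k)).
  have [e2 h'] := chart_eq Du Dk e.
  case: h' => [pole|uk|[u0 kn]|[un k0]].
  + exfalso; move: pole; rewrite e2 /= normr0; lra.
  + move: ju uj; rewrite uk /= !ler_nat => jk kj.
    have [kj'|kj'] := eqVneq (k : nat) j; first by left; exact: val_inj.
    right; apply: val_inj => /=; have kE : k = j.+1 :> nat by lia.
    by rewrite -kE modn_small.
  + move: kn => /= /eqP; rewrite eqr_nat => /eqP kn.
    by have := ltn_ord k; rewrite kn ltnn.
  + right; apply: val_inj => /=; move: uj; rewrite un ler_nat => nj.
    have -> : j.+1 = n by apply/eqP; rewrite eqn_leq nj ltn_ord.
    by rewrite modnn; move/eqP: k0; rewrite /= pnatr_eq0 => /eqP.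
- have := @closure_curve R _ (region (inl j))
    (fun t => chart (j%:R + t * 1, 0 + t * 0)) 1.
  rewrite !mul0r !addr0; apply => //; first exact: continuous_chart_line.
  by move=> t t01; rewrite mulr1 mulr0 addr0; exact: mid.
- rewrite chart_ordS.
  have := @closure_curve R _ (region (inl j))
    (fun t => chart (j.+1%:R + t * (-1), 0 + t * 0)) 1.
  rewrite !mul0r !addr0; apply => //; first exact: continuous_chart_line.
  move=> t /andP[t0 t1]; rewrite mulrN1 mulr0 addr0 -(natr1 j) -addrA.
  by apply: mid; apply/andP; split; lra.
Qed.

Lemma regions_connectedP f g : f != g ->
  regions_connected L (region f) (region g) <-> linked f g.
Proof.
move=> fg.
have -> : regions_connected L (region f) (region g) <-> exists k : 'I_n,
    (if f is inl j then k = j \/ k = ordS j else True) /\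
    (if g is inl j then k = j \/ k = ordS j else True).
  split=> [[p /crossingsP[k ->] [bf bg]]|[k [bf bg]]].
    by exists k; split; apply/boundary_region.
  exists (chart (k%:R, 0)); first by apply/crossingsP; exists k.
  by split; apply/boundary_region.
case: f g fg => [i|b] [j|c] //= ij; last first.
- by split=> // _; exists (Ordinal n_gt0).
- by split=> // _; exists j; split=> //; left.
- by split=> // _; exists i; split=> //; left.
split=> [[k [[ki|ki] [kj|kj]]]|/orP[/eqP ji|/eqP ij']].
- by rewrite -ki -kj eqxx in ij.
- by rewrite -ki kj eqxx orbT.
- by rewrite -kj ki eqxx.
- have := @ordS_inj n i j; rewrite -ki -kj => /(_ erefl) e.
  by rewrite e eqxx in ij.
- by exists j; split; [right|left].
- by exists i; split; [left|right].
Qed.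

(** * Isolated sets of regions *)

Let image_of (A : {set 'I_n + bool}) : set (set 'rV[R]_3) :=
  region @` [set f | f \in A].

Lemma isolated_bij :
  set_bij [set A : {set 'I_n + bool} | unlinked_set A]
    [set W | Defs.isolated L W] image_of.
Proof.
have mem (A : {set 'I_n + bool}) f : image_of A (region f) <-> f \in A.
  by split=> [[g gA /region_inj<-]|fA]; last by exists f.
split.
- move=> A /= hA; split=> [U [f fA <-]|U V [f fA <-] [g gA <-] ne].
    by rewrite regions_range; exists f.
  have fg : f != g by apply/eqP => e; apply: ne; rewrite e.
  move=> /(regions_connectedP fg); apply/negP.
  by move/forall_inP/(_ _ fA)/forall_inP/(_ _ gA) : hA; rewrite fg.
- move=> A B _ _ e; apply/setP => f; apply/idP/idP => /mem.
    by rewrite e => /mem.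
  by rewrite -e => /mem.
- move=> W /= [Wreg Wsep]; exists [set f | `[< W (region f) >]]%SET.
    apply/forall_inP => f; rewrite inE => /asboolP Wf.
    apply/forall_inP => g; rewrite inE => /asboolP Wg.
    apply/implyP => fg; apply/negP => /(regions_connectedP fg).
    by apply: Wsep => // /region_inj e; rewrite e eqxx in fg.
  apply/seteqP; split=> [U [f /=]|U WU].
    by rewrite inE => /asboolP Wf <-.
  have := Wreg _ WU; rewrite regions_range => -[f _ fU].
  by exists f => //=; rewrite inE fU; apply/asboolP.
Qed.

Lemma I_generating_function_unlinked :
  I_generating_function L =
  \sum_(A : {set 'I_n + bool} | unlinked_set A) 'X^#|A|.
Proof.
rewrite /I_generating_function (reindex_fsbig image_of _ _ _ isolated_bij).
rewrite -(bigfs _ (r := index_enum {set 'I_n + bool}) (P := @unlinked_set n))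
  ?index_enum_uniq//=; last first.
  by move=> A _; rewrite mem_index_enum.
apply: eq_bigr => A _; congr ('X^_).
have fin : finite_set [set f | f \in A] by exact: finite_finset.
rewrite /image_of fset_set_image// card_imfset /=; last exact: region_inj.
rewrite cardE; apply/perm_size/uniq_perm;
  [exact: fset_uniq|exact: enum_uniq|move=> f].
by rewrite in_fset_set// mem_enum; apply/idP/idP; rewrite inE.
Qed.

End Regions.

Theorem theorem2 (R : realType) (n : nat) (n_ge4 : (4 <= n)%N) :
  I_generating_function
    (@torus_projection R n (leq_trans (isT : (0 < 4)%N) n_ge4)) =
  1 + (n + 2)%:R *: 'X +
  \sum_(2 <= k < (n %/ 2).+1)
     ('C(n - k, k)%:R * (n%:R / (n - k)%:R)) *: 'X^k.
Proof. by rewrite I_generating_function_unlinked sum_unlinked_closed. Qed.
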